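(* Let $W:\mathrm{GL}^+(3)\to\mathbb{R}$ be an isotropic elastic energy potential of the form $$W(F)=W_{\mathrm{tc}}(F)+f(\det F),$$ where $W_{\mathrm{tc}}:\mathrm{GL}^+(3)\to\mathbb{R}$ is a continuously differentiable isotropic tension-compression symmetric function, i.e. $W_{\mathrm{tc}}(F^{-1})=W_{\mathrm{tc}}(F)$ for all $F\in\mathrm{GL}^+(3)$, and $f:(0,\infty)\to\mathbb{R}$ is differentiable with $f'(1)=0$. Then for every $\alpha\in\mathbb{R}$, the Cauchy stress $\hat\sigma(V_\alpha^2)$ corresponding to the finite pure shear stretch $$V_\alpha=\begin{pmatrix}\cosh\alpha&\sinh\alpha&0\\ \sinh\alpha&\cosh\alpha&0\\ 0&0&1\end{pmatrix}$$ is a pure shear stress, i.e. there exists $s\in\mathbb{R}$ with $\hat\sigma(V_\alpha^2)=\begin{pmatrix}0&s&0\\ s&0&0\\ 0&0&0\end{pmatrix}$.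
   Context: $\mathrm{GL}^+(3)$ denotes the real $3\times3$ matrices with positive determinant. A function $W:\mathrm{GL}^+(3)\to\mathbb{R}$ is (objective and) isotropic if $W(Q_1FQ_2)=W(F)$ for all $F\in\mathrm{GL}^+(3)$ and $Q_1,Q_2\in\mathrm{SO}(3)$; then $W(F)$ can be written as a permutation-invariant function $W(\lambda_1,\lambda_2,\lambda_3)$ of the singular values of $F$. The Cauchy stress induced by $W$ is $\hat\sigma(FF^T)=\frac{1}{\det F}\,DW(F)\,F^T$. For $B=V^2$ with $V$ symmetric positive definite with eigenvalues $\lambda_i$, $\hat\sigma(B)$ is diagonal in the same orthonormal eigenbasis as $V$, with eigenvalues $\sigma_i=\frac{\lambda_i}{\lambda_1\lambda_2\lambda_3}\frac{\partial W}{\partial\lambda_i}(\lambda_1,\lambda_2,\lambda_3)$. *)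

(* Defs.v *)
From HB Require Import structures.
From mathcomp Require Export all_boot all_order all_algebra.
From mathcomp Require Export all_classical all_reals all_analysis.

Set Implicit Arguments.
Unset Strict Implicit.
Unset Printing Implicit Defensive.

Import Order.TTheory GRing.Theory Num.Theory.
Import numFieldNormedType.Exports.

Local Open Scope classical_set_scope.
Local Open Scope ring_scope.

Section elasticity.
Context {R : realType}.
Implicit Types (F B Q : 'M[R]_3) (W : 'M[R]_3 -> R).

Definition GLplus : set 'M[R]_3 := [set F | 0 < \det F].

Definition SO3 : set 'M[R]_3 := [set Q | Q *m Q^T = 1%:M /\ \det Q = 1].

(* A function on GL^+(3) is represented by a total function on 'M[R]_3 whose
   values outside the open set GLplus are irrelevant. *)
Definition isotropic W : Prop :=
  forall F Q1 Q2, GLplus F -> SO3 Q1 -> SO3 Q2 -> W (Q1 *m F *m Q2) = W F.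

Definition tension_compression_symmetric W : Prop :=
  forall F, GLplus F -> W (invmx F) = W F.

(* DW(F), identified with a matrix through the Frobenius inner product: its
   (i, j) entry is the partial derivative of W with respect to F_ij. *)
Definition gradient W F : 'M[R]_3 :=
  \matrix_(i, j) 'd W F (delta_mx i j).

Definition continuously_differentiable W : Prop :=
  forall F, GLplus F ->
    differentiable W F /\ {for F, continuous (gradient W)}.

Definition cauchy_stress_of W F : 'M[R]_3 :=
  (\det F)^-1 *: (gradient W F *m F^T).

(* The response function sigma^ determined by
   sigma^(F F^T) = cauchy_stress_of W F. For isotropic W the value does not
   depend on the choice of F, see cauchy_stressE. The default value 0 is only
   taken when B is not of the form F F^T with F in GLplus. *)
Definition cauchy_stress W B : 'M[R]_3 :=
  xget 0 [set cauchy_stress_of W F | F in [set F | GLplus F /\ F *m F^T = B]].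

Lemma continuous_det : continuous (fun F : 'M[R]_3 => \det F).
Proof.
apply: (@continuous_big R^o _ +%R 0 xpredT add_continuous) => s _.
have prod_continuous (t : 'I_3 -> 'I_3) :
    continuous (fun F : 'M[R]_3 => \prod_i F i (t i)).
  apply: (@continuous_big R^o _ *%R 1 xpredT mul_continuous) => i _.
  exact: coord_continuous.
move=> F; apply: (@cvgMl_tmp _ _ (nbhs F)).
exact: (prod_continuous (perm.fun_of_perm s)).
Qed.

Lemma near_GLplus F : GLplus F -> \forall X \near F, GLplus X.
Proof.
move=> F0; suff : nbhs (\det F) [set y : R | 0 < y]
  by exact: (@continuous_det F).
by apply: open_nbhs_nbhs; split => //; exact: open_gt.
Qed.

Lemma gradient_mulmx_SO3 W F Q :
    isotropic W -> (forall X, GLplus X -> differentiable W X) ->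
    GLplus F -> SO3 Q ->
  gradient W (F *m Q) = gradient W F *m Q.
Proof.
move=> Wiso Wd F0 [QQT detQ]; apply/matrixP => i j.
have FQ0 : GLplus (F *m Q) by rewrite /GLplus/= det_mulmx detQ mulr1.
have SO1 : SO3 1%:M by split; rewrite ?trmx1 ?mulmx1 ?det1.
have QTQ : Q^T *m Q = 1%:M by apply: mulmx1C.
rewrite !mxE -deriveE; last exact: Wd.
transitivity ('D_(delta_mx i j *m Q^T) (fun X => W (X *m Q)) F).
  rewrite /derive; under [in RHS]eq_fun do
    rewrite /= mulmxDl -scalemxAl -mulmxA QTQ mulmx1.
  by [].
rewrite (@near_eq_derive _ _ _ _ W); last first.
  have := near_GLplus F0; apply: filterS => X X0.
  by rewrite -[X in X *m Q]mul1mx Wiso.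
rewrite deriveE; last exact: Wd.
have -> : delta_mx i j *m Q^T = \sum_k Q k j *: delta_mx i k.
  apply/matrixP => a b; rewrite summxE !mxE (bigD1 j)//= big1 => [|k kj].
    rewrite (bigD1 b)//= big1 => [|k kb].
      by rewrite !mxE !eqxx !andbT !addr0 mulrC.
    by rewrite !mxE [b == k]eq_sym (negbTE kb) andbF mulr0.
  by rewrite !mxE (negbTE kj) andbF mul0r.
rewrite linear_sum; apply: eq_bigr => k _.
by rewrite linearZ/= mxE mulrC.
Qed.

Lemma cauchy_stressE W F :
    isotropic W -> (forall X, GLplus X -> differentiable W X) -> GLplus F ->
  cauchy_stress W (F *m F^T) = cauchy_stress_of W F.
Proof.
move=> Wiso Wd F0; apply: xget_unique; first by exists F.
move=> _ [G [G0 GF] <-].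
have uF : F \in unitmx by rewrite unitmxE unitfE gt_eqF.
pose Q := invmx F *m G.
have GE : G = F *m Q by rewrite mulmxA mulmxV // mul1mx.
have QQT : Q *m Q^T = 1%:M.
  rewrite trmx_mul mulmxA -[_ *m G *m G^T]mulmxA GF mulmxA mulVmx // mul1mx.
  by rewrite -trmx_mul mulVmx // trmx1.
have detQ : \det Q = 1.
  have Q0 : 0 < \det Q by rewrite det_mulmx det_inv mulr_gt0 ?invr_gt0.
  move/(congr1 determinant): QQT; rewrite det_mulmx det_tr det1 -expr2 => /eqP.
  by rewrite pexpr_eq1 ?ltW // => /eqP.
rewrite /cauchy_stress_of GE gradient_mulmx_SO3 //.
by rewrite det_mulmx detQ mulr1 trmx_mul mulmxA -(mulmxA _ Q) QQT mulmx1.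
Qed.

Definition cosh (x : R) : R := (expR x + expR (- x)) / 2.
Definition sinh (x : R) : R := (expR x - expR (- x)) / 2.

Definition mx33 (a11 a12 a13 a21 a22 a23 a31 a32 a33 : R) : 'M[R]_3 :=
  \matrix_(i < 3, j < 3)
    nth 0 (nth [::] [:: [:: a11; a12; a13];
                        [:: a21; a22; a23];
                        [:: a31; a32; a33]] i) j.

Definition pure_shear_stretch (alpha : R) : 'M[R]_3 :=
  mx33 (cosh alpha) (sinh alpha) 0
       (sinh alpha) (cosh alpha) 0
       0            0            1.

Definition pure_shear_stress (s : R) : 'M[R]_3 :=
  mx33 0 s 0
       s 0 0
       0 0 0.

End elasticity.

(* Main.v *)
(** At the stretch [V] the gradient of [Wtc] inherits every rotation symmetry
    [Q1 V Q2 = V]; the half turn about [e1 + e2], which swaps the first two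
    axes, and the half turn about the third axis force it to have the block form
    [[a, b], [b, a]] + [g]. For an
    orthogonal projection [D] commuting with [V] put [S t = 1 + (exp t - 1) D],
    so that [S (- t)] is the inverse of [S t]. The half turn [Q] about the first
    axis conjugates [V] to its inverse, hence tension-compression symmetry makes
    [t |-> Wtc (S t V)] even and its derivative at [0], which is the stress
    component along [D], vanishes. This is applied to the projections on the
    third axis and on its orthogonal plane. Finally [\det V = 1] and
    [f' 1 = 0] make the volumetric term invisible. *)
Require Import Defs.
From mathcomp Require Import ring lra.

Import Order.TTheory GRing.Theory Num.Theory.
Import numFieldNormedType.Exports.

Local Open Scope classical_set_scope.
Local Open Scope ring_scope.

(** * Fréchet differentials of germs, determinants and restrictions to lines *)

Section differential.
Set Implicit Arguments.
Unset Strict Implicit.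
Context {R : realType}.

(** The first-order expansion at [x] only sees the germ of the function. This matters because [W]
    splits as [Wtc + f \o det] only on the open set [GLplus]. *)
Lemma near_eq_differentiable (U V : normedModType R) (f g : U -> V) (x : U) :
  (\forall y \near x, f y = g y) -> differentiable g x ->
  differentiable f x /\ 'd f x = 'd g x :> (U -> V).
Proof.
move=> fg dg; have [dgc gE] := proj1 (diff_locallyP _ _) dg.
have fE : f \o shift x = cst (f x) + 'd g x +o_ 0 id.
  apply/eqaddoP => e e0; move/eqaddoP: gE => /(_ e e0).
  have : \forall h \near 0, f (h + x) = g (h + x).
    by move: fg; rewrite [X in X -> _](near_shift 0) subr0.
  apply: filterS2 => h /= fgh.
  by rewrite /= !fctE /= fgh (nbhs_singleton fg).
have dE := diff_unique dgc fE.
split; last exact: dE.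
by apply/diff_locallyP; rewrite dE; split; [exact: dgc|exact: fE].
Qed.

Lemma differentiable_det n (F : 'M[R]_n.+1) :
  differentiable (fun X : 'M[R]_n.+1 => \det X : R) F.
Proof.
have dprod (t : 'I_n.+1 -> 'I_n.+1) (r : seq 'I_n.+1) :
    differentiable (fun X : 'M[R]_n.+1 => \prod_(i <- r) X i (t i) : R) F.
  elim: r => [|i r IH].
    rewrite (_ : (fun _ => _) = cst 1); first exact: differentiable_cst.
    by apply/funext => X; rewrite big_nil.
  rewrite (_ : (fun _ => _) =
    (fun X : 'M[R]_n.+1 => X i (t i) : R) *
    (fun X : 'M[R]_n.+1 => \prod_(i <- r) X i (t i) : R)).
    by apply: differentiableM => //; exact: differentiable_coord.
  by apply/funext => X; rewrite big_cons.
rewrite /determinant; elim: (index_enum _) => [|s r IH].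
  rewrite (_ : (fun _ => _) = cst 0); first exact: differentiable_cst.
  by apply/funext => X; rewrite big_nil.
rewrite (_ : (fun _ => _) =
  (cst ((-1) ^+ (perm.odd_perm s)) *
   (fun X : 'M[R]_n.+1 => \prod_i X i (perm.fun_of_perm s i) : R)) +
  (fun X : 'M[R]_n.+1 => \sum_(s <- r)
     (-1) ^+ (perm.odd_perm s) * \prod_i X i (perm.fun_of_perm s i) : R)).
  apply: differentiableD => //; apply: differentiableM.
    exact: differentiable_cst.
  exact: dprod.
by apply/funext => X; rewrite big_cons.
Qed.

Lemma is_derive_along_line {U : normedModType R} (f : U -> R) (x v : U) :
  differentiable f x ->
  is_derive (0 : R) 1 (fun u : R => f (u *: v + x)) ('d f x v).
Proof.
move=> df.
have E : (fun h : R => h^-1 *: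
      (((fun u : R => f (u *: v + x)) \o shift 0) (h *: (1 : R)) -
       f (0 *: v + x))) =
    (fun h : R => h^-1 *: ((f \o shift x) (h *: v) - f x)).
  by apply/funext => h /=; rewrite scale0r add0r addr0 [h *: 1]mulr1.
split; last by rewrite -deriveE // /derive E.
by rewrite /derivable E; apply: diff_derivable.
Qed.

End differential.

(** * Symmetries of the differential of an isotropic function *)

Section isotropic_functions.
Set Implicit Arguments.
Unset Strict Implicit.
Context {R : realType}.
Implicit Types (F H V D Q : 'M[R]_3) (W : 'M[R]_3 -> R).

Lemma SO3_tr Q : SO3 Q -> SO3 Q^T.
Proof. by move=> [QQ dQ]; split; rewrite ?det_tr // trmxK; exact: mulmx1C. Qed.

Lemma diff_gradient W F H :
  'd W F H = \sum_i \sum_j gradient W F i j * H i j.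
Proof.
rewrite [in LHS](matrix_sum_delta H) linear_sum; apply: eq_bigr => i _.
rewrite linear_sum; apply: eq_bigr => j _.
by rewrite linearZ/= mxE mulrC.
Qed.

(** Differentiate [W (Q1 *m X *m Q2) = W X], valid for [X] near [F], at the fixed point [F] of the
    action. *)
Lemma diff_isotropic_sym W F H Q1 Q2 :
    isotropic W -> GLplus F -> differentiable W F -> SO3 Q1 -> SO3 Q2 ->
    Q1 *m F *m Q2 = F ->
  'd W F (Q1 *m H *m Q2) = 'd W F H.
Proof.
move=> Wiso F0 dW SQ1 SQ2 QF; rewrite -!deriveE //.
transitivity ('D_H (fun X => W (Q1 *m X *m Q2)) F).
  rewrite /derive; under [in RHS]eq_fun do
    rewrite /= mulmxDr mulmxDl -scalemxAr -scalemxAl QF.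
  by [].
apply: near_eq_derive; apply: filterS (near_GLplus F0) => X X0.
exact: Wiso.
Qed.

(** Dual form of the invariance of ['d W F]: for the Frobenius product, the adjoint of
    [H |-> Q1 *m H *m Q2] is [G |-> Q1^T *m G *m Q2^T]. *)
Lemma gradient_isotropic_sym W F Q1 Q2 :
    isotropic W -> GLplus F -> differentiable W F -> SO3 Q1 -> SO3 Q2 ->
    Q1 *m F *m Q2 = F ->
  gradient W F = Q1^T *m gradient W F *m Q2^T.
Proof.
move=> Wiso F0 dW SQ1 SQ2 QF; apply/matrixP => i j.
rewrite [LHS]mxE -(diff_isotropic_sym _ Wiso F0 dW SQ1 SQ2 QF) diff_gradient.
rewrite [RHS]mxE exchange_big; apply: eq_bigr => l _ /=.
rewrite mxE mulr_suml; apply: eq_bigr => k _.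
rewrite !mxE (bigD1 j) //= big1 ?addr0 => [|b bj].
  rewrite mxE (bigD1 i) //= big1 ?addr0 => [|a ai].
    by rewrite mxE !eqxx /=; ring.
  by rewrite mxE (negbTE ai) mulr0.
rewrite mxE big1 ?mul0r // => a _.
by rewrite mxE (negbTE bj) andbF mulr0.
Qed.

Lemma diff_volumetric W Wtc (f : R -> R) F :
    GLplus F -> (forall X, GLplus X -> W X = Wtc X + f (\det X)) ->
    differentiable Wtc F -> derivable f (\det F) 1 ->
  differentiable W F /\
  forall H, 'd W F H =
    'd Wtc F H + 'd (fun X : 'M[R]_3 => \det X) F H * (f^`())%classic (\det F).
Proof.
move=> F0 WE dWtc /derivable1_diffP df.
have ddet := differentiable_det F.
have dfdet := differentiable_comp ddet df.
have nearW : \forall X \near F,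
    W X = (Wtc + (f \o (fun X : 'M[R]_3 => \det X))) X.
  by apply: filterS (near_GLplus F0) => X; exact: WE.
have [dW ->] := near_eq_differentiable nearW (differentiableD dWtc dfdet).
split=> // H; rewrite diffD //=; congr (_ + _).
rewrite [LHS](congr1 (fun g : _ -> _ => g H) (diff_comp ddet df)) /=.
by rewrite derive1E' // -[X in 'd f _ X]mulr1 linearZ.
Qed.

Lemma diff_tension_compression W V D Q :
    isotropic W -> tension_compression_symmetric W ->
    GLplus V -> differentiable W V -> SO3 Q ->
    V *m (Q *m V *m Q^T) = 1%:M -> D *m D = D -> D *m V = V *m D ->
    Q *m D = D *m Q ->
  'd W V (D *m V) = 0.
Proof.
move=> Wiso Wtc V0 dW SQ QV DD DV QD.
pose oppfun (t : R) := - t.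
pose p t : R := expR t - 1; pose S t := 1%:M + p t *: D.
have SM s t : S s *m S t = S (s + t).
  rewrite /S mulmxDl mul1mx mulmxDr mulmx1 -scalemxAl -scalemxAr DD.
  rewrite scalerA -!addrA -!scalerDl; congr (_ + _ *: _).
  by rewrite /p expRD; ring.
(* [S t] is invertible with inverse [S (- t)], and it is the square of [S (t / 2)], so its
   determinant is nonzero and nonnegative. *)
have S0 t : GLplus (S t).
  have E : S t = S (t / 2) *m S (t / 2) by rewrite SM -splitr.
  have : S t *m S (- t) = 1%:M.
    by rewrite SM subrr /S /p expR0 subrr scale0r addr0.
  move/(congr1 determinant); rewrite det_mulmx det1 => dS1.
  rewrite /GLplus/= lt0r; apply/andP; split.
    apply/eqP => d0; move: dS1; rewrite d0 mul0r => /esym/eqP.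
    by rewrite oner_eq0.
  by rewrite E det_mulmx -expr2 sqr_ge0.
have SV t : S t *m V = V *m S t.
  by rewrite mulmxDl mulmxDr mul1mx mulmx1 -scalemxAl -scalemxAr DV.
have QS t : Q *m S t = S t *m Q.
  by rewrite mulmxDl mulmxDr mul1mx mulmx1 -scalemxAl -scalemxAr QD.
have SV0 t : GLplus (S t *m V).
  by rewrite /GLplus/= det_mulmx mulr_gt0 //; exact: S0.
(* Conjugating [S (- t) *m V] by [Q] gives [S (- t)] times the inverse of [V], which is the inverse
   of [S t *m V]. *)
have even t : W (S (- t) *m V) = W (S t *m V).
  rewrite -(Wtc (S t *m V)) // -(Wiso _ Q Q^T (SV0 (- t)) SQ (SO3_tr SQ)).
  have uSV : S t *m V \in unitmx.
    by rewrite unitmxE unitfE gt_eqF //; exact: SV0.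
  congr W; apply: (can_inj (mulmxK uSV)); rewrite mulVmx //.
  have -> : Q *m (S (- t) *m V) *m Q^T = S (- t) *m (Q *m V *m Q^T).
    by rewrite !mulmxA QS.
  rewrite SV -[LHS]mulmxA [_ *m (V *m _)]mulmxA (mulmx1C QV) mul1mx SM addNr.
  by rewrite /S /p expR0 subrr scale0r addr0.
(* The curve [S t *m V] runs along the line [V + u *: (D *m V)] with [u = p t], [p 0 = 0] and [p] of
   slope 1 at 0. Evenness then equates the derivative of [k] at 0 with its opposite. *)
pose k u := W (u *: (D *m V) + V).
have kS t : W (S t *m V) = (k \o p) t.
  by rewrite /k /= /S mulmxDl mul1mx -scalemxAl addrC.
have dk : is_derive (0 : R) 1 k ('d W V (D *m V)) by exact: is_derive_along_line.
have p0 : p 0 = 0 by rewrite /p expR0 subrr.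
have dp : is_derive (0 : R) 1 p 1.
  by apply: is_derive_eq; rewrite expR0 subr0.
have dN : is_derive (0 : R) 1 oppfun (-1).
  by have := is_deriveN (is_derive_id (0 : R) 1).
have oppfun0 : oppfun 0 = 0 by rewrite /oppfun oppr0.
have dpN : is_derive (0 : R) 1 (p \o oppfun) (1 * -1).
  by apply: is_derive1_comp; rewrite oppfun0.
have d1 : is_derive (0 : R) 1 (k \o p) ('d W V (D *m V) * 1).
  by apply: is_derive1_comp; rewrite p0.
have d2 : is_derive (0 : R) 1 (k \o (p \o oppfun))
    ('d W V (D *m V) * (1 * -1)).
  by apply: is_derive1_comp; rewrite /= oppfun0 p0.
have E : k \o (p \o oppfun) = k \o p.
  by apply/funext => t; rewrite -kS -even kS.
rewrite E in d2; have := derive_val (is_derive := d1).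
by rewrite (derive_val (is_derive := d2)); lra.
Qed.

End isotropic_functions.

(** * Explicit computation with 3 by 3 matrices *)

Section matrices33.
Set Implicit Arguments.
Unset Strict Implicit.
Context {R : realType}.

(* In ['I_3] the index [-1] is [2]. *)
Lemma mx33_eta (A : 'M[R]_3) : A = mx33 (A 0 0) (A 0 1) (A 0 (-1))
  (A 1 0) (A 1 1) (A 1 (-1)) (A (-1) 0) (A (-1) 1) (A (-1) (-1)).
Proof.
by apply/matrixP => -[[|[|[|i]]] Hi] // [[|[|[|j]]] Hj] //; rewrite !mxE /=;
  congr (A _ _); exact: val_inj.
Qed.

Lemma tr_mx33 (a b c d e f g h i : R) :
  (mx33 a b c d e f g h i)^T = mx33 a d g b e h c f i.
Proof. by apply/matrixP => -[[|[|[|?]]] ?] // [[|[|[|?]]] ?] //; rewrite !mxE. Qed.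

Lemma mul_mx33 (a b c d e f g h i a' b' c' d' e' f' g' h' i' : R) :
  mx33 a b c d e f g h i *m mx33 a' b' c' d' e' f' g' h' i' =
  mx33 (a * a' + b * d' + c * g') (a * b' + b * e' + c * h')
       (a * c' + b * f' + c * i')
       (d * a' + e * d' + f * g') (d * b' + e * e' + f * h')
       (d * c' + e * f' + f * i')
       (g * a' + h * d' + i * g') (g * b' + h * e' + i * h')
       (g * c' + h * f' + i * i').
Proof.
by apply/matrixP => -[[|[|[|?]]] ?] // [[|[|[|?]]] ?] //; rewrite !mxE /=;
  rewrite !big_ord_recl big_ord0 !mxE /= addr0 addrA.
Qed.

Lemma mx33_1 : 1%:M = mx33 1 0 0 0 1 0 0 0 1 :> 'M[R]_3.
Proof. by apply/matrixP => -[[|[|[|?]]] ?] // [[|[|[|?]]] ?] //; rewrite !mxE. Qed.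

Lemma det_mx33 (a b c d e f g h i : R) :
  \det (mx33 a b c d e f g h i) =
  a * (e * i - f * h) - b * (d * i - f * g) + c * (d * h - e * g).
Proof.
rewrite (expand_det_row _ 0) !big_ord_recl big_ord0 /cofactor.
rewrite !(expand_det_row _ 0) !big_ord_recl !big_ord0 /cofactor !det_mx11.
rewrite !mxE /=; ring.
Qed.

Lemma cosh2_sub_sinh2 (x : R) : cosh x * cosh x - sinh x * sinh x = 1.
Proof.
have := expRxMexpNx_1 x; rewrite /cosh /sinh => E.
by transitivity (expR x * expR (- x)); first field.
Qed.

End matrices33.

Theorem theorem4p2 (R : realType) (W Wtc : 'M[R]_3 -> R) (f : R -> R)
    (W_isotropic : isotropic W)
    (Wtc_C1 : continuously_differentiable Wtc)
    (Wtc_isotropic : isotropic Wtc)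
    (Wtc_symmetric : tension_compression_symmetric Wtc)
    (f_differentiable : forall x : R, 0 < x -> derivable f x 1)
    (f'1 : (f^`())%classic 1 = 0)
    (W_split : forall F : 'M[R]_3, GLplus F -> W F = Wtc F + f (\det F))
    (alpha : R) :
  exists s : R,
    cauchy_stress W (pure_shear_stretch alpha *m pure_shear_stretch alpha)
    = pure_shear_stress s.
Proof.
(* Of the hyperbolic functions only [c * c - s * s = 1] is kept. *)
have := erefl (pure_shear_stretch alpha); rewrite {2}/pure_shear_stretch.
move: (pure_shear_stretch alpha) (cosh alpha) (sinh alpha)
  (cosh2_sub_sinh2 alpha).
move=> V c s cs VE.
have VT : V^T = V by rewrite VE tr_mx33.
have detV : \det V = 1 by rewrite VE det_mx33; lra.
have V0 : GLplus V by rewrite /GLplus/= detV.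
have dWtc X : GLplus X -> differentiable Wtc X by move=> /Wtc_C1[].
have vol X (X0 : GLplus X) :=
  diff_volumetric X0 W_split (dWtc X X0) (f_differentiable _ X0).
have gradW : gradient W V = gradient Wtc V.
  apply/matrixP => i j; rewrite [LHS]mxE [RHS]mxE.
  by have [_ ->] := vol _ V0; rewrite detV f'1 mulr0 addr0.
(* As [V] is symmetric, [V *m V] is [V *m V^T], so [V] itself can represent the argument of the
   stress response. *)
rewrite -{2}VT (cauchy_stressE W_isotropic (fun X X0 => proj1 (vol X X0)) V0).
rewrite /cauchy_stress_of detV invr1 scale1r gradW VT.
(* Half turns about the first axis, the third axis and [e1 + e2]. [Q1] inverts [V] by flipping the
   sign of [s]; [Q3] and [P] fix [V]. *)
pose Q1 : 'M[R]_3 := mx33 1 0 0 0 (-1) 0 0 0 (-1).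
pose Q3 : 'M[R]_3 := mx33 (-1) 0 0 0 (-1) 0 0 0 1.
pose P : 'M[R]_3 := mx33 0 1 0 1 0 0 0 0 (-1).
have SQ1 : SO3 Q1.
  split; first by rewrite tr_mx33 mul_mx33 mx33_1; congr mx33; ring.
  by rewrite det_mx33; ring.
have SQ3 : SO3 Q3.
  split; first by rewrite tr_mx33 mul_mx33 mx33_1; congr mx33; ring.
  by rewrite det_mx33; ring.
have SP : SO3 P.
  split; first by rewrite tr_mx33 mul_mx33 mx33_1; congr mx33; ring.
  by rewrite det_mx33; ring.
have QV : V *m (Q1 *m V *m Q1^T) = 1%:M.
  by rewrite VE tr_mx33 !mul_mx33 mx33_1; congr mx33; lra.
(* The sum is the Frobenius product of [D] with the stress [gradient Wtc V *m V^T]. *)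
have stress0 D : D *m D = D -> D *m V = V *m D -> Q1 *m D = D *m Q1 ->
    \sum_i \sum_j gradient Wtc V i j * (D *m V) i j = 0.
  move=> DD DV QD; rewrite -diff_gradient.
  exact: diff_tension_compression (dWtc _ V0) SQ1 QV DD DV QD.
have GQ3 : gradient Wtc V = Q3^T *m gradient Wtc V *m Q3^T.
  apply: (gradient_isotropic_sym Wtc_isotropic V0 (dWtc _ V0) SQ3 SQ3).
  by rewrite VE !mul_mx33; congr mx33; ring.
have GP : gradient Wtc V = P^T *m gradient Wtc V *m P^T.
  apply: (gradient_isotropic_sym Wtc_isotropic V0 (dWtc _ V0) SP SP).
  by rewrite VE !mul_mx33; congr mx33; ring.
pose D1 : 'M[R]_3 := mx33 1 0 0 0 1 0 0 0 0.
pose D3 : 'M[R]_3 := mx33 0 0 0 0 0 0 0 0 1.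
have T1 : \sum_i \sum_j gradient Wtc V i j * (D1 *m V) i j = 0.
  by apply: stress0; rewrite ?VE !mul_mx33; congr mx33; ring.
have T3 : \sum_i \sum_j gradient Wtc V i j * (D3 *m V) i j = 0.
  by apply: stress0; rewrite ?VE !mul_mx33; congr mx33; ring.
move: (gradient Wtc V) T1 T3 GQ3 GP => G.
rewrite (mx33_eta G); move: (G 0 0) (G 0 1) (G 0 (-1)) (G 1 0) (G 1 1)
  (G 1 (-1)) (G (-1) 0) (G (-1) 1) (G (-1) (-1)) => a b d e g h k l m.
rewrite VE !tr_mx33 !mul_mx33 !big_ord_recl !big_ord0 !mxE /=.
move=> T1 T3 /matrixP GQ3 /matrixP GP.
(* [Q3] flips the sign of the entries coupling the third axis to the others; [P] exchanges the first
   two axes. *)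
have d0 : d = 0 by have := GQ3 0 (-1); rewrite !mxE /=; lra.
have h0 : h = 0 by have := GQ3 1 (-1); rewrite !mxE /=; lra.
have k0 : k = 0 by have := GQ3 (-1) 0; rewrite !mxE /=; lra.
have l0 : l = 0 by have := GQ3 (-1) 1; rewrite !mxE /=; lra.
have eb : e = b by have := GP 0 1; rewrite !mxE /=; lra.
have ga : g = a by have := GP 0 0; rewrite !mxE /=; lra.
(* The witness is the off-diagonal entry of the stress. [T1] now reads [2 * (a * c + b * s) = 0],
   which kills the first two diagonal entries, and [T3] gives [m = 0]. *)
subst d h k l e g; exists (a * s + b * c).
congr mx33; lra.
Qed.
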